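(* Let $\mathbf{k}$ be a field and $\Gamma$ a $(d-1)$-dimensional simplicial complex on $[n]$ with upper skips $1=Q_0<Q_1<\dots<Q_{d-1}$. For $1\le i\le d-1$ set $$c_i=\prod_{1\le u\le d-1,\,u\neq i}Q_u(Q_u-1)\prod_{1\le u<v\le d-1,\ u,v\neq i}(Q_v-Q_u).$$ Then $f_{d-1}(\Gamma)\le\frac{1}{(n-d)!}\prod_{i=1}^{n-d}M_i(S/I_\Gamma)$ if and only if $$\sum_{i=1}^{d-1}c_i\sum_{j=0}^{i-1}(-1)^{i-j-1}A(j,Q_i)\ge0.$$
   Context: A simplicial complex on $[n]$ is a family of subsets closed under subsets containing all singletons; $f_i$ counts faces of size $i+1$. For $S=\mathbf{k}[x_1,\dots,x_n]$ and Stanley–Reisner ideal $I_\Gamma$, $M_i=\max\{|W|:W\subseteq[n],\ \tilde H_{|W|-i-1}(\Gamma[W];\mathbf{k})\neq0\}$ (maximal shifts of the minimal free resolution of $S/I_\Gamma$). For $1\le i\le n-d$ these are strictly increasing integers in $\{2,\dots,n\}$; the $d$ elements of $[n]$ not among $M_1,\dots,M_{n-d}$ are the upper skips $Q_0=1<Q_1<\dots<Q_{d-1}$. For $0\le p<d$ and $1\le m\le n$, $A(p,m)=\binom{n}{m}^{-1}\sum_{W\subseteq[n],|W|=m}\tilde\beta_p(\Gamma[W];\mathbf{k})$, where $\tilde\beta_p=\dim_{\mathbf{k}}\tilde H_p$ and $\Gamma[W]$ is the induced subcomplex. *)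

(* Defs.v *)
From HB Require Import structures.
From mathcomp Require Import all_boot all_order all_algebra.
Set Implicit Arguments. Unset Strict Implicit. Unset Printing Implicit Defensive.
Import Order.TTheory GRing.Theory Num.Theory.
Local Open Scope ring_scope.

(* Vertex set [n] is modelled by 'I_n (vertex v+1 of the paper is v : 'I_n).
   A simplicial complex is a family of faces Gamma : {set {set 'I_n}}. *)

Definition is_simplicial_complex (n : nat) (Gamma : {set {set 'I_n}}) : Prop :=
  (forall sigma tau : {set 'I_n}, sigma \in Gamma -> tau \subset sigma -> tau \in Gamma)
  /\ (forall v : 'I_n, [set v] \in Gamma).

(* Gamma is (d-1)-dimensional: its largest faces have exactly d vertices. *)
Definition has_dim (n : nat) (Gamma : {set {set 'I_n}}) (d : nat) : Prop :=
  (exists2 sigma, sigma \in Gamma & #|sigma| = d)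
  /\ (forall sigma, sigma \in Gamma -> (#|sigma| <= d)%N).

(* f-vector entry: number of faces of size s (= f_{s-1}). *)
Definition fnum (n : nat) (Gamma : {set {set 'I_n}}) (s : nat) : nat :=
  #|[set sigma in Gamma | #|sigma| == s]|.

(* faces of the induced subcomplex Gamma[W] with exactly s vertices
   (these span the chain group C_{s-1}, s = 0 is the empty face). *)
Definition faces (n : nat) (Gamma : {set {set 'I_n}}) (W : {set 'I_n}) (s : nat)
  : {set {set 'I_n}} :=
  [set sigma in Gamma | (sigma \subset W) && (#|sigma| == s)].

(* Simplicial boundary map C_s -> C_{s-1} of Gamma[W] (faces of size s+1 to
   faces of size s), as a matrix acting on row vectors, in the bases given
   by enumerating the faces. Orientation: by the order of 'I_n. *)
Definition bdmx (k : fieldType) (n : nat) (Gamma : {set {set 'I_n}})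
  (W : {set 'I_n}) (s : nat)
  : 'M[k]_(#|faces Gamma W s.+1|, #|faces Gamma W s|) :=
  \matrix_(i, j)
    let sigma := @enum_val _ (mem (faces Gamma W s.+1)) i in
    let tau := @enum_val _ (mem (faces Gamma W s)) j in
    if tau \subset sigma then
      (-1) ^+ #|[set u in tau | [exists v in sigma :\: tau, (u < v)%N]]|
    else 0.

(* Dimension of reduced homology tilde H_{s-1}(Gamma[W]; k)
   = dim C_{s-1} - rank(d_{s-1}) - rank(d_s). *)
Definition rbetti (k : fieldType) (n : nat) (Gamma : {set {set 'I_n}})
  (W : {set 'I_n}) (s : nat) : nat :=
  (#|faces Gamma W s|
   - (if s is s'.+1 then \rank (bdmx k Gamma W s') else 0)
   - \rank (bdmx k Gamma W s))%N.

(* M_i = max{|W| : tilde H_{|W|-i-1}(Gamma[W]; k) <> 0}; homology in degree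
   |W|-i-1 < -1 vanishes, so we require |W| >= i (size index s = |W| - i). *)
Definition Mshift (k : fieldType) (n : nat) (Gamma : {set {set 'I_n}}) (i : nat)
  : nat :=
  \max_(W : {set 'I_n} | (i <= #|W|)%N && (rbetti k Gamma W (#|W| - i) != 0%N))
     #|W|.

Definition upper_skips (k : fieldType) (n : nat) (Gamma : {set {set 'I_n}})
  (d : nat) : seq nat :=
  [seq m <- iota 1 n | m \notin [seq Mshift k Gamma i | i <- iota 1 (n - d)]].

Definition Qskip (k : fieldType) (n : nat) (Gamma : {set {set 'I_n}})
  (d : nat) (u : nat) : nat := nth 0%N (upper_skips k Gamma d) u.

Definition Aavg (k : fieldType) (n : nat) (Gamma : {set {set 'I_n}})
  (p m : nat) : rat :=
  (\sum_(W : {set 'I_n} | #|W| == m) (rbetti k Gamma W p.+1)%:R)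
    / ('C(n, m))%:R.

Definition cco (k : fieldType) (n : nat) (Gamma : {set {set 'I_n}})
  (d : nat) (i : nat) : rat :=
  let Q := Qskip k Gamma d in
  (\prod_(1 <= u < d | u != i) ((Q u)%:R * ((Q u)%:R - 1)))
  * (\prod_(1 <= u < d | u != i) \prod_(u.+1 <= v < d | v != i)
        ((Q v)%:R - (Q u)%:R)).

(* Main.v *)
Require Import Defs.
From HB Require Import structures.
From mathcomp Require Import all_boot all_order all_algebra.
From mathcomp Require Import zify ring.
Set Implicit Arguments. Unset Strict Implicit. Unset Printing Implicit Defensive.
Import Order.TTheory GRing.Theory Num.Theory.
Local Open Scope ring_scope.

(** Averaging the Euler-Poincare formula over the vertex sets [W] of size [m]
gives a polynomial [P] of degree [d] in [m], with [P(0) = 1] and leading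
coefficient [(-1)^d f_{d-1} (n-d)!/n!], whose value at [m] is the alternating
sum of the averages [A(p,m)].  By the definition of the maximal shifts,
[A(p,Q_i) = 0] for [p >= i]; in particular [P(Q_0) = 0], and [P(Q_i)] is up to
sign the inner sum of the theorem.  Interpolating [P] at [0, Q_0, ..., Q_{d-1}]
expresses its leading coefficient through these values, and since the shifts and
the skips partition [1..n], the contribution of [P(0)] is [prod M_i / n!] up to
sign.

That the shifts [M_1 < ... < M_{n-d}] are strictly increasing follows from: if
[H_p(Gamma[W]) <> 0] and [p + n - |W| >= d], then [H_{p+|W'|-|W|-1}(Gamma[W'])
<> 0] for some [W'] strictly containing [W].  Otherwise the long exact sequences
of the complexes [{t in Gamma | B <= t <= W \cup B}] would propagate the
nonvanishing from [B = set0] to [B = ~: W], where a face with more than [d]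
vertices would be needed. *)

(** * Chains on the full simplex, convex families and exact sequences *)

Section Chains.

Variables (k : fieldType) (n : nat).
Implicit Types (x y : {set 'I_n} -> k) (F : pred {set 'I_n}) (s t B W : {set 'I_n}).

Definition bd_sign (v : 'I_n) t : k := (-1) ^+ #|[set u in t | (u < v)%N]|.

Definition bd x t : k := \sum_(v | v \notin t) bd_sign v t * x (v |: t).

Definition chain_in F q x := forall t, x t != 0 -> F t && (#|t| == q).

(** A convex family [F] of sets spans a subquotient of the chain complex of the
full simplex: terms of the boundary outside [F] are discarded.  [q] is the number
of vertices, one more than the dimension. *)
Definition acyclic_at F q := forall x, chain_in F q x ->
  (forall t, F t -> bd x t = 0) ->
  exists2 y, chain_in F q.+1 y & forall t, F t -> bd y t = x t.

Definition restrict F x t : k := if F t then x t else 0.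

Definition convex F := forall s t u : {set 'I_n},
  F s -> F u -> s \subset t -> t \subset u -> F t.

Lemma chain_in0 F q x t : chain_in F q x -> ~~ F t -> x t = 0.
Proof. by move=> h; apply: contraNeq => /h/andP[]. Qed.

Lemma eq_bd x y t : (forall v, v \notin t -> x (v |: t) = y (v |: t)) ->
  bd x t = bd y t.
Proof. by move=> h; apply: eq_bigr => v /h ->. Qed.

Lemma bdB x y t : bd (fun s => x s - y s) t = bd x t - bd y t.
Proof. by rewrite /bd -sumrB; apply: eq_bigr => v _; rewrite mulrBr. Qed.

(** Adding the smaller vertex [v] puts one more vertex below [w], while adding [w] changes nothing
    below [v]. *)
Lemma bd_sign_swap v w t : v \notin t -> w \notin t -> (v < w)%N ->
  bd_sign v t * bd_sign w (v |: t) = - (bd_sign w t * bd_sign v (w |: t)).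
Proof.
move=> vt wt vw; rewrite /bd_sign.
have -> : [set u in v |: t | (u < w)%N] = v |: [set u in t | (u < w)%N].
  by apply/setP=> u; rewrite !inE; case: (eqVneq u v) => [->|_] /=; rewrite ?vw.
have -> : [set u in w |: t | (u < v)%N] = [set u in t | (u < v)%N].
  apply/setP=> u; rewrite !inE; case: (eqVneq u w) => [->|_] //=.
  by rewrite ltnNge (ltnW vw) andbF.
rewrite cardsU1 inE (negbTE vt) /= exprS mulN1r.
by rewrite mulrN [X in - X]mulrC.
Qed.

Lemma bd_bd x t : bd (bd x) t = 0.
Proof.
pose P (p : 'I_n * 'I_n) := [&& p.1 \notin t, p.2 \notin t & (p.1 < p.2)%N].
pose g v w := bd_sign v t * (bd_sign w (v |: t) * x (w |: (v |: t))).
have -> : bd (bd x) t = \sum_(p | P p) g p.1 p.2 + \sum_(p | P p) g p.2 p.1.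
  have -> : bd (bd x) t =
      \sum_(v | v \notin t) \sum_(w | (w \notin t) && (w != v)) g v w.
    apply: eq_bigr => v _; rewrite [bd x _]/bd big_distrr /=.
    by apply: eq_bigl => w; rewrite !inE negb_or andbC.
  rewrite pair_big_dep /= (bigID (fun p : 'I_n * 'I_n => (p.1 < p.2)%N)) /=.
  congr (_ + _).
    by apply: eq_bigl => -[v w]; rewrite /P /=; case: ltngtP => //=;
      rewrite ?andbF ?andbT // => h; rewrite -(inj_eq val_inj) /= gtn_eqF ?andbT.
  rewrite (reindex_inj (h := fun p : 'I_n * 'I_n => (p.2, p.1))) /=; last first.
    by move=> [a b] [c e] [-> ->].
  apply: eq_bigl => -[v w]; rewrite /P /= -leqNgt ltn_neqAle -(inj_eq val_inj) /=.
  by rewrite -!andbA; do 2![case: (_ \notin t) => //=].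
rewrite -big_split /= big1 // => -[v w] /and3P[/= vt wt vw].
by rewrite /g !mulrA bd_sign_swap // setUCA mulNr addNr.
Qed.

(** Convexity makes truncation harmless: a set of [F] above a discarded [v |: t] would force
    [v |: t] into [F], so the discarded coefficient was already zero. *)
Lemma bd_restrict_bd F q x t : convex F -> chain_in F q x -> F t ->
  bd (restrict F (bd x)) t = 0.
Proof.
move=> cF xF Ft; rewrite -[RHS](bd_bd x t); apply: eq_bd => v vt.
rewrite /restrict; case: ifPn => // nF; rewrite /bd big1 // => w wt.
rewrite (chain_in0 xF) ?mulr0 //; apply: contra nF => Fw.
by apply: cF Ft Fw _ _; rewrite subsetUr.
Qed.

Lemma chain_in_restrict_bd F F' q x : chain_in F q.+1 x ->
  chain_in F' q (restrict F' (bd x)).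
Proof.
move=> xF t; rewrite /restrict; case: ifP => [_ /= bx|_]; last by rewrite eqxx.
apply: contraR bx => ct; rewrite /bd big1 // => v vt.
have [->|/xF/andP[_]] := eqVneq (x (v |: t)) 0; first by rewrite mulr0.
by rewrite cardsU1 vt add1n eqSS (negbTE ct).
Qed.

Section LongExactSequence.

Variables (F : pred {set 'I_n}) (v : 'I_n).
Hypothesis cF : convex F.
Let F1 t := F t && (v \notin t).
Let F2 t := F t && (v \in t).

Lemma bd_avoiding q y t : chain_in F1 q y -> v \in t -> bd y t = 0.
Proof.
move=> yF vt; rewrite /bd big1 // => w _.
by rewrite (chain_in0 yF) ?mulr0 // /F1 negb_and negbK !inE vt !orbT.
Qed.

Lemma bd_restrict_containing q y t : chain_in F q y -> v \in t ->
  bd (restrict F2 y) t = bd y t.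
Proof.
move=> yF vt; apply: eq_bd => w _; rewrite /restrict /F2 !inE vt orbT andbT.
by case: ifPn => // nF; rewrite (chain_in0 yF).
Qed.

Lemma chain_in_restrict q y : chain_in F q y -> chain_in F2 q (restrict F2 y).
Proof.
move=> yF t; rewrite /restrict; case: ifP => [_ /yF/andP[_ ->] //|_].
by rewrite eqxx.
Qed.

(** [F1] spans a subcomplex of [F] with quotient [F2]: this and the next lemma
are two exactness statements of the long exact homology sequence. *)
Lemma acyclic_containing q :
  acyclic_at F q.+1 -> acyclic_at F1 q -> acyclic_at F2 q.+1.
Proof.
move=> aF aF1 x xF x0.
(* The connecting map: [x] is a cycle only modulo [F1], and filling [w] by a chain [u] in [F1] makes
   [x - u] a cycle of [F]. *)
pose w := restrict F1 (bd x).
have xFF : chain_in F q.+1 x by move=> t /xF/andP[/andP[-> _] ->].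
have wF : chain_in F1 q w by apply: chain_in_restrict_bd xF.
have w0 t : F1 t -> bd w t = 0.
  move=> /andP[Ft vt]; rewrite -[RHS](bd_restrict_bd cF xFF Ft).
  apply: eq_bd => u _; rewrite /w /restrict /F1.
  case: (boolP (F _)) => //= Fu; case: (boolP (v \in _)) => //= vu.
  by rewrite x0 // /F2 Fu.
have [u uF ue] := aF1 w wF w0.
have [||y yF ye] := aF (fun s => x s - u s).
- move=> t; have [->|/xFF //] := eqVneq (x t) 0.
  by rewrite sub0r oppr_eq0 => /uF/andP[/andP[-> _] ->].
- move=> t Ft; rewrite bdB; case: (boolP (v \in t)) => vt.
    by rewrite x0 ?/F2 ?Ft // (bd_avoiding uF) // subrr.
  by rewrite ue /F1 ?Ft // /w /restrict /F1 Ft vt subrr.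
exists (restrict F2 y); first exact: chain_in_restrict.
move=> t /andP[Ft vt]; rewrite (bd_restrict_containing yF) // ye //.
by rewrite (chain_in0 uF) ?subr0 // /F1 vt andbF.
Qed.

Lemma acyclic_avoiding q :
  acyclic_at F q -> acyclic_at F2 q.+1 -> acyclic_at F1 q.
Proof.
move=> aF aF2 x xF x0.
have [||y yF ye] := aF x.
- by move=> t /xF/andP[/andP[-> _] ->].
- move=> t Ft; case: (boolP (v \in t)) => vt; first exact: bd_avoiding xF vt.
  by rewrite x0 // /F1 Ft.
have [||z zF ze] := aF2 (restrict F2 y).
- exact: chain_in_restrict.
- move=> t /andP[Ft vt]; rewrite (bd_restrict_containing yF) // ye //.
  by rewrite (chain_in0 xF) // /F1 vt andbF.
have zFF : chain_in F q.+2 z by move=> t /zF/andP[/andP[-> _] ->].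
(* On [F2] the boundary of [z] equals [y]; subtracting the boundary of [z] in all of [F] moves [y]
   into [F1] and keeps its boundary. *)
exists (fun t => y t - restrict F (bd z) t).
  move=> t; case: (boolP (F2 t)) => [F2t|nF2].
    have /andP[Ft vt] := F2t.
    by rewrite /restrict Ft ze // /restrict F2t subrr eqxx.
  move=> h; suff /andP[Ft ->] : F t && (#|t| == q.+1).
    by rewrite andbT /F1 Ft; move: nF2; rewrite /F2 Ft.
  have [y0|/yF //] := eqVneq (y t) 0.
  move: h; rewrite y0 sub0r oppr_eq0; exact: (chain_in_restrict_bd zFF).
move=> t /andP[Ft vt]; rewrite bdB (bd_restrict_bd cF zFF) // subr0.
exact: ye.
Qed.

End LongExactSequence.

End Chains.

(** * Relative complexes and propagation of acyclicity *)

Lemma disjoint_setU1 (T : finType) (x : T) (A B : {set T}) :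
  [disjoint x |: A & B] = (x \notin B) && [disjoint A & B].
Proof. by rewrite !disjoints_subset subUset sub1set inE. Qed.

Lemma eq_acyclic_at (k : fieldType) n (F F' : pred {set 'I_n}) q :
  F =1 F' -> acyclic_at k F q -> acyclic_at k F' q.
Proof.
move=> e aF x xF x0; have [|t|y yF ye] := aF x; rewrite ?e; try exact: x0.
  by move=> t; rewrite e; apply: xF.
by exists y => t; rewrite -e; [apply: yF | apply: ye].
Qed.

Section RelativeComplexes.

Variables (k : fieldType) (n : nat) (Gamma : {set {set 'I_n}}).
Implicit Types (s t B W : {set 'I_n}).
Hypothesis hGamma : is_simplicial_complex Gamma.

(** Up to a shift of degrees, the chain complex of the link of [B] in
[Gamma[W :|: B]]. *)
Definition star_faces W B t :=
  [&& t \in Gamma, B \subset t & t \subset W :|: B].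

Lemma star_faces_convex W B : convex (star_faces W B).
Proof.
move=> s t u /and3P[_ Bs _] /and3P[uG _ uW] st tu; apply/and3P; split.
- by case: hGamma => /(_ _ _ uG tu).
- exact: subset_trans Bs st.
- exact: subset_trans tu uW.
Qed.

Lemma star_faces_avoiding v W B : v \notin W :|: B ->
  (fun t => star_faces (v |: W) B t && (v \notin t)) =1 star_faces W B.
Proof.
move=> vWB t; rewrite /star_faces -!andbA; do 2!congr (_ && _).
by rewrite -setUA -subsetD1 setU1K.
Qed.

Lemma star_faces_containing v W B :
  (fun t => star_faces (v |: W) B t && (v \in t)) =1 star_faces W (v |: B).
Proof.
move=> t; rewrite /star_faces subUset sub1set setUCA -setUA -!andbA.
by do ![case: (_ \in _) => //=]; rewrite ?andbF ?andbT.
Qed.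

(** Induction on [#|B|]: a vertex [v] of [B] splits the family of [v |: W'] and [B :\ v]. The whole
    and the part avoiding [v] are acyclic by induction, as [v |: W'] also strictly contains [W]; the
    part containing [v] is the family of [W'] and [B]. *)
Lemma acyclic_star_ind (q : nat) W :
    (forall W', W \proper W' ->
      acyclic_at k (star_faces W' set0) (q + #|W'| - #|W| - 1)%N) ->
  forall B W', W \proper W' -> [disjoint B & W'] ->
  acyclic_at k (star_faces W' B) (q + #|W'| + #|B| - #|W| - 1)%N.
Proof.
move=> h B; have [b] := ubnP #|B|; elim: b B => // b IH B ltB W' WW' dB.
have [->|[v vB]] := set_0Vmem B; first by rewrite cards0 addn0; apply: h.
have ltW := proper_card WW'.
have vW' : v \notin W' by rewrite (disjointFr dB).
have eB : B = v |: (B :\ v) by rewrite setD1K.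
have cB : #|B| = #|B :\ v|.+1 by rewrite [LHS](cardsD1 v) vB.
have dB' : [disjoint B :\ v & W'] by apply: disjointWl dB; rewrite subsetDl.
have ltB' : (#|B :\ v| < b)%N by rewrite cB in ltB.
have a1 := IH _ ltB' _ WW' dB'.
have WvW' : W \proper v |: W' by rewrite (proper_sub_trans WW') ?subsetUr.
have dvB' : [disjoint B :\ v & v |: W'].
  by rewrite disjoint_sym disjoint_setU1 ?inE ?eqxx //= disjoint_sym.
have a2 := IH _ ltB' _ WvW' dvB'.
rewrite eB; apply: eq_acyclic_at (star_faces_containing v W' (B :\ v)) _.
rewrite cardsU1 vW' in a2.
have -> : (q + #|W'| + #|v |: B :\ v| - #|W| - 1 =
           (q + #|W'| + #|B :\ v| - #|W| - 1).+1)%N.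
  by rewrite -eB cB; lia.
apply: (acyclic_containing (@star_faces_convex (v |: W') (B :\ v))).
  have -> : (q + #|W'| + #|B :\ v| - #|W| - 1).+1 =
    (q + (true + #|W'|) + #|B :\ v| - #|W| - 1)%N by lia.
  exact: a2.
apply: eq_acyclic_at a1 => t.
by rewrite star_faces_avoiding // !inE eqxx orbF.
Qed.

(** Induction on the number of vertices outside [W :|: B]. Such a vertex [v] splits the family of
    [v |: W] and [B]: the whole is acyclic by [acyclic_star_ind], the part containing [v] by
    induction with [v |: B], and [acyclic_avoiding] gives the rest. *)
Lemma acyclic_of_supersets (d q : nat) W : has_dim Gamma d -> (d < q + (n - #|W|))%N ->
  (forall W', W \proper W' ->
      acyclic_at k (star_faces W' set0) (q + #|W'| - #|W| - 1)%N) ->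
  acyclic_at k (star_faces W set0) q.
Proof.
move=> [_ hd] ltd h.
suff key B : [disjoint B & W] -> acyclic_at k (star_faces W B) (q + #|B|)%N.
  by have := key set0; rewrite cards0 addn0; apply; rewrite disjoints_subset sub0set.
have [b] := ubnP (#|~: (W :|: B)|); elim: b B => // b IH B ltB dB.
have [e0|[v vWB]] := set_0Vmem (~: (W :|: B)).
  (* Now [q + #|B|] is [q + (n - #|W|) > d], more vertices than any face has, so every chain is
     zero. *)
  have cWB : (#|W| + #|B| = n)%N.
    have := cardsUI W B; rewrite [W :&: B]setIC (disjoint_setI0 dB) cards0.
    by have := cardsC (W :|: B); rewrite e0 cards0 card_ord; lia.
  move=> x xF _; have x0 t : x t = 0.
    apply/eqP/negPn/negP => /xF/andP[/and3P[/hd tG _ _] /eqP ct].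
    by move: tG; rewrite ct; lia.
  exists (fun=> 0) => t; rewrite ?eqxx // => _.
  by rewrite x0 /bd big1 // => v _; rewrite mulr0.
move: vWB; rewrite inE => vWB; have := vWB; rewrite inE negb_or => /andP[vW vB].
apply: eq_acyclic_at (star_faces_avoiding vWB) _.
apply: (acyclic_avoiding (@star_faces_convex (v |: W) B)).
  have -> : (q + #|B| = q + #|v |: W| + #|B| - #|W| - 1)%N.
    by rewrite cardsU1 vW; lia.
  apply: acyclic_star_ind h _ _ _ _; first by rewrite properUr // sub1set.
  by rewrite disjoint_sym disjoint_setU1 vB disjoint_sym.
apply: eq_acyclic_at (fun t => esym (star_faces_containing v W B t)) _.
have -> : ((q + #|B|).+1 = q + #|v |: B|)%N by rewrite cardsU1 vB; lia.
apply: IH; last by rewrite disjoint_setU1 vW.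
rewrite ltnS in ltB; apply: leq_trans ltB; apply: proper_card.
apply/properP; split; first by rewrite setCS setUS ?subsetUr.
by exists v; rewrite !inE ?eqxx ?orbT //= negb_or vW vB.
Qed.

End RelativeComplexes.

(** * Boundary matrices, ranks and exactness *)

Lemma rank_defect_eq0 (k : fieldType) m p r (A : 'M[k]_(m, p)) (B : 'M[k]_(r, m)) :
  B *m A = 0 ->
  (m - \rank A - \rank B = 0)%N <->
  (forall u : 'rV_m, u *m A = 0 -> exists w, u = w *m B).
Proof.
move=> BA0; rewrite -mxrank_ker; have /sub_kermxP sB := BA0.
have [_ e] := mxrank_leqif_sup sB.
split=> [/eqP | h].
  rewrite subn_eq0 => le_r u /sub_kermxP uK; apply/submxP.
  by apply: submx_trans uK _; rewrite -e eqn_leq mxrankS.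
apply/eqP; rewrite subn_eq0; apply: mxrankS; apply/row_subP => i.
by apply/submxP/h; rewrite -row_mul mulmx_ker row0.
Qed.

Section BoundaryMatrices.

Variables (k : fieldType) (n : nat) (Gamma : {set {set 'I_n}}).
Hypothesis hGamma : is_simplicial_complex Gamma.
Variable W : {set 'I_n}.
Implicit Types (s : nat) (t : {set 'I_n}) (x y : {set 'I_n} -> k).

Notation Fc := (star_faces Gamma W set0).
Notation fc := (faces Gamma W).
Notation D := (bdmx k Gamma W).

Lemma star_faces0E t : Fc t = (t \in Gamma) && (t \subset W).
Proof. by rewrite /star_faces sub0set setU0. Qed.

Lemma in_faces s t : (t \in fc s) = Fc t && (#|t| == s).
Proof. by rewrite inE star_faces0E andbA. Qed.

Definition chain_row s x : 'rV[k]_(#|fc s|) :=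
  \row_i x (@enum_val _ (mem (fc s)) i).

Definition row_chain s (u : 'rV[k]_(#|fc s|)) t : k :=
  \sum_i u 0 i *+ (@enum_val _ (mem (fc s)) i == t).

Lemma row_chainK s u : chain_row s (row_chain u) = u.
Proof.
apply/rowP=> j; rewrite mxE /row_chain (bigD1 j) //= eqxx mulr1n big1 ?addr0 //.
by move=> i /negPf; rewrite (inj_eq enum_val_inj) => ->.
Qed.

Lemma chain_in_row_chain s (u : 'rV_(#|fc s|)) : chain_in Fc s (row_chain u).
Proof.
move=> t; rewrite -in_faces; apply: contraR => tF.
rewrite /row_chain big1 // => i _.
case: eqP => // e; case/negP: tF; rewrite -e; exact: enum_valP.
Qed.

Arguments chain_in_row_chain {s} u [t].

Lemma chain_in_notin s x t : chain_in Fc s x -> t \notin fc s -> x t = 0.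
Proof. by move=> xF; apply: contraNeq => /xF; rewrite in_faces. Qed.

Lemma eq_chain_row s x y : chain_row s x = chain_row s y ->
  forall t, t \in fc s -> x t = y t.
Proof.
move=> e t tF; rewrite -(enum_rankK_in tF tF).
by move/rowP: e => /(_ (enum_rank_in tF t)); rewrite !mxE.
Qed.

Lemma chain_in_bd s x : chain_in Fc s.+1 x -> chain_in Fc s (bd x).
Proof.
move=> xF t; apply: contraR => h; rewrite /bd big1 // => v vt.
have [->|/xF] := eqVneq (x (v |: t)) 0; first by rewrite mulr0.
rewrite cardsU1 vt add1n eqSS => /andP[Fvt ct]; case/negP: h.
rewrite ct andbT star_faces0E; move: Fvt; rewrite star_faces0E.
case/andP => /(hGamma.1 _ t) /(_ (subsetUr _ _)) -> /=.
exact: subset_trans (subsetUr _ _).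
Qed.

Lemma chain_row_mul_bdmx s x : chain_in Fc s.+1 x ->
  chain_row s.+1 x *m D s = chain_row s (bd x).
Proof.
move=> xF; apply/rowP => j; rewrite !mxE.
set t := enum_val j; have := enum_valP j; rewrite -/t in_faces => /andP[_ /eqP ct].
pose g (u : {set 'I_n}) : k := if t \subset u then
  (-1) ^+ #|[set a in t | [exists b in u :\: t, (a < b)%N]]| else 0.
transitivity (\sum_(u in fc s.+1) x u * g u).
  rewrite (big_enum_val (A := mem (fc s.+1))) /=.
  by apply: eq_bigr => i _; rewrite !mxE.
(* The faces with [s.+1] vertices containing [t] are of the form [v |: t]; the other faces have
   [g u = 0], and the [v |: t] that are not faces have [x u = 0]. *)
transitivity (\sum_(u in [set v |: t | v in ~: t]) x u * g u).
  rewrite (bigID (mem [set v |: t | v in ~: t])) /= addrC big1 ?add0r; last first.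
    move=> u /andP[]; rewrite in_faces => /andP[_ cu] /negP nu.
    rewrite /g; case: ifP => [tu|_]; last by rewrite mulr0.
    have /cards1P[v ev] : #|u :\: t| == 1%N.
      by rewrite cardsD (setIidPr tu) (eqP cu) ct subSnn.
    case: nu; apply/imsetP; exists v.
      by have := set11 v; rewrite -ev !inE => /andP[].
    by rewrite -ev setUC -[X in X :|: _](setIidPr tu) setID.
  rewrite [RHS](bigID (mem (fc s.+1))) /= [X in _ = _ + X]big1 ?addr0.
    by apply: eq_bigl => u; rewrite andbC.
  by move=> u /andP[_ uF]; rewrite (chain_in_notin xF) ?mul0r.
rewrite big_imset /=; last first.
  move=> v w; rewrite !inE => vt wt e.
  have : v \in w |: t by rewrite -e setU11.
  by rewrite !inE (negPf vt) orbF => /eqP.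
rewrite /bd; apply: eq_big => v; rewrite ?inE // => vt.
(* Only [v] lies in [v |: t] but not in [t], so the existential in the sign of [bdmx] reduces to
   [a < v]. *)
rewrite mulrC /g subsetUr; congr (_ * _); congr (_ ^+ #|pred_of_set _|).
apply/setP=> a; rewrite !inE; congr (_ && _).
apply/existsP/idP => [[b /andP[]]|av].
  by rewrite !inE => /andP[bt]; rewrite (negPf bt) orbF => /eqP ->.
by exists v; rewrite !inE vt eqxx.
Qed.

Lemma bdmx_mul s : D s.+1 *m D s = 0.
Proof.
apply/row_matrixP => i; rewrite row_mul rowE row0.
rewrite -[delta_mx 0 i]row_chainK; set c := row_chain _.
have cF : chain_in Fc s.+2 c by apply: chain_in_row_chain.
rewrite chain_row_mul_bdmx // chain_row_mul_bdmx; last exact: chain_in_bd.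
by apply/rowP=> j; rewrite !mxE bd_bd.
Qed.

Lemma rbetti_eq0 s : rbetti k Gamma W s = 0%N <-> acyclic_at k Fc s.
Proof.
pose cyc (u : 'rV[k]_(#|fc s|)) := forall t, Fc t -> bd (row_chain u) t = 0.
have step p (A : 'M[k]_(#|fc s|, p)) : D s *m A = 0 ->
    (forall u, u *m A = 0 <-> cyc u) ->
    (#|fc s| - \rank A - \rank (D s) = 0)%N <-> acyclic_at k Fc s.
  move=> DA hA; rewrite rank_defect_eq0 //; split=> h.
    move=> x xF x0; have e := row_chainK (chain_row s x).
    have ex t : row_chain (chain_row s x) t = x t.
      case: (boolP (t \in fc s)) => [|tF]; first exact: eq_chain_row.
      by rewrite (chain_in_notin (chain_in_row_chain _)) ?(chain_in_notin xF).
    have [|w ew] := h (chain_row s x).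
      apply/hA => r rF; rewrite -[RHS](x0 r rF).
      by apply: eq_bd => v _; apply: ex.
    have wF := chain_in_row_chain w.
    exists (row_chain w) => // t Ft.
    case: (boolP (t \in fc s)) => [tF|tF].
      apply: eq_chain_row tF; rewrite -chain_row_mul_bdmx // row_chainK; exact: esym.
    by rewrite (chain_in_notin (chain_in_bd wF)) ?(chain_in_notin xF).
  move=> u /hA cu; have [y yF ye] := h _ (chain_in_row_chain u) cu.
  exists (chain_row _ y); rewrite chain_row_mul_bdmx // -[LHS]row_chainK.
  apply/rowP => i; rewrite !mxE ye //.
  by have := enum_valP i; rewrite in_faces => /andP[].
rewrite /rbetti; case: s @cyc step => [|s] cyc step.
  (* In size 0 a zero matrix stands in for the outgoing boundary; every chain is a cycle because
     [v |: t] is never empty. *)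
  have := step 1%N 0; rewrite mxrank0; apply; first by rewrite mulmx0.
  move=> u; rewrite mulmx0; split=> // _ t _; rewrite /bd big1 // => v _.
  rewrite (_ : row_chain _ _ = 0) ?mulr0 //.
  apply/eqP/negPn/negP => /(chain_in_row_chain u) /andP[_].
  by rewrite cards_eq0 => /eqP/setP/(_ v); rewrite !inE eqxx.
apply: step; first exact: bdmx_mul.
move=> u; have uF := chain_in_row_chain u.
rewrite -{1}[u]row_chainK chain_row_mul_bdmx //; split=> [e t Ft|h].
  case: (boolP (t \in fc s)) => [tF|tF].
    by apply: (eq_chain_row (y := fun=> 0) _ tF); rewrite e; apply/rowP=> i; rewrite !mxE.
  by rewrite (chain_in_notin (chain_in_bd uF)).
apply/rowP=> i; rewrite !mxE h //.
by have := enum_valP i; rewrite in_faces => /andP[].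
Qed.

(** The subtractions in [rbetti] never truncate: the ranks of two matrices with product zero add up
    to at most the middle dimension. *)
Lemma card_faces_rbetti s :
  #|fc s| = (rbetti k Gamma W s
   + (if s is s'.+1 then \rank (D s') else 0) + \rank (D s))%N.
Proof.
rewrite /rbetti; case: s => [|s].
  by have := rank_leq_col (D 0); lia.
by have := mulmx0_rank_max (bdmx_mul s); lia.
Qed.

End BoundaryMatrices.

(** * Extreme homology and monotonicity of the maximal shifts *)

Section Shifts.

Variables (k : fieldType) (n d : nat) (Gamma : {set {set 'I_n}}).
Hypotheses (hGamma : is_simplicial_complex Gamma) (hdim : has_dim Gamma d).
Implicit Types (i s : nat) (W t : {set 'I_n}).

Notation beta := (rbetti k Gamma).
Notation M := (Mshift k Gamma).

Lemma card_vertices_leq W : (#|W| <= n)%N.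
Proof. by rewrite -[X in (_ <= X)%N]card_ord max_card. Qed.

Lemma dim_leq : (d <= n)%N.
Proof. by have [[s _ <-] _] := hdim; apply: card_vertices_leq. Qed.

(** Contrapositive of [acyclic_of_supersets]. The new index makes size minus index grow by exactly
    one, so a set counted in [M i] yields a larger one counted in [M i.+1]. *)
Lemma rbetti_superset s W : (d < s + (n - #|W|))%N -> beta W s != 0%N ->
  exists2 W' : {set 'I_n}, W \proper W' & beta W' (s + #|W'| - #|W| - 1)%N != 0%N.
Proof.
move=> ltd bW.
case: (boolP [exists W' : {set 'I_n},
    (W \proper W') && (beta W' (s + #|W'| - #|W| - 1)%N != 0%N)]).
  by case/existsP=> W' /andP[]; exists W'.
rewrite negb_exists => /forallP h; case/eqP: bW; apply/(rbetti_eq0 k hGamma).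
apply: (acyclic_of_supersets hGamma hdim ltd) => W' WW'.
apply/(rbetti_eq0 k hGamma)/eqP.
by have := h W'; rewrite WW' /= negbK.
Qed.

(** The only possible face is [W] itself, and a nonzero multiple of it has a nonzero boundary
    coefficient at [W :\ v]. *)
Lemma rbetti_top0 W s : (0 < #|W| <= s)%N -> beta W s = 0%N.
Proof.
case/andP=> /card_gt0P[v vW] leWs; apply/(rbetti_eq0 k hGamma) => x xF x0.
suff xE t : x t = 0.
  exists (fun=> 0) => t; rewrite ?eqxx // => _; rewrite xE /bd big1 // => w _.
  by rewrite mulr0.
apply/eqP/negPn/negP => xt; have := xF _ xt.
rewrite star_faces0E => /andP[/andP[tG tW] /eqP ct].
have et : t = W by apply/eqP; rewrite eqEcard tW ct.
rewrite {t tW}et in tG ct xt.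
have vNW : v \notin W :\ v by rewrite !inE eqxx.
have := x0 (W :\ v); rewrite star_faces0E subD1set.
rewrite (hGamma.1 _ _ tG) ?subD1set // => /(_ isT).
rewrite /bd (bigD1 v) //= setD1K // big1 => [|w /andP[]].
  by move/eqP; rewrite addr0 mulf_eq0 signr_eq0 (negPf xt).
rewrite !inE => /negPf wW wv; apply/eqP; rewrite mulf_eq0; apply/orP; right.
apply/negPn/negP => /xF; rewrite star_faces0E => /andP[/andP[_ /subsetP/(_ w)]].
rewrite setU11 => /(_ isT) wW'; by rewrite wv wW' in wW.
Qed.

Lemma rbetti_bot0 W : (0 < #|W|)%N -> beta W 0 = 0%N.
Proof.
case/card_gt0P=> v vW; apply/(rbetti_eq0 k hGamma) => x xF _.
(* The empty face is the boundary of the single vertex [v]. *)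
exists (fun t => x set0 *+ (t == [set v])) => t.
  have [->|_] := eqVneq t [set v]; last by rewrite mulr0n eqxx.
  by rewrite star_faces0E hGamma.2 sub1set vW cards1.
move=> _; have [->|/set0Pn[w wt]] := eqVneq t set0.
  rewrite /bd (bigD1 v) ?inE //= setU0 eqxx big1 => [|w /andP[_ wv]].
    rewrite addr0 /bd_sign (_ : [set _ in _ | _] = set0) ?cards0 ?mul1r //.
    by apply/setP=> u; rewrite !inE.
  by rewrite setU0 (inj_eq set1_inj) (negPf wv) mulr0.
rewrite /bd big1.
  apply/esym/eqP/negPn/negP => /xF/andP[_]; rewrite cards_eq0 => /eqP t0.
  by rewrite t0 inE in wt.
move=> u ut; case: eqP => [e|]; last by rewrite mulr0.
have := cards1 v; rewrite -e cardsU1 ut; have : (0 < #|t|)%N by apply/card_gt0P; exists w.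
by case: #|t|.
Qed.

Lemma rbetti_set0 : beta set0 0 != 0%N.
Proof.
apply/eqP => /(rbetti_eq0 k hGamma) a.
have G0 : set0 \in Gamma.
  by have [[s sG _] _] := hdim; apply: (hGamma.1 _ _ sG (sub0set s)).
have [||y yF ye] := a (fun t => (t == set0)%:R).
- move=> t; have [->|_] := eqVneq t set0; last by rewrite eqxx.
  by rewrite star_faces0E G0 sub0set cards0.
- move=> t _; rewrite /bd big1 // => v _.
  by rewrite (_ : _ == set0 = false) ?mulr0 //; apply/set0Pn; exists v; rewrite setU11.
have := ye set0; rewrite star_faces0E G0 sub0set => /(_ isT) /eqP.
rewrite eqxx /bd big1 ?(eq_sym 0) ?oner_eq0 // => v _.
apply/eqP; rewrite mulf_eq0; apply/orP; right.
apply/negPn/negP => /yF; rewrite star_faces0E => /andP[/andP[_ /subsetP/(_ v)]].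
by rewrite setU11 inE => /(_ isT).
Qed.

Lemma leq_Mshift i W : (i <= #|W|)%N -> beta W (#|W| - i) != 0%N -> (#|W| <= M i)%N.
Proof.
move=> iW bW.
by apply: (leq_bigmax_cond (F := fun W : {set 'I_n} => #|W|)); rewrite iW.
Qed.

Lemma Mshift_leq i : (M i <= n)%N.
Proof. by apply/bigmax_leqP => W _; apply: card_vertices_leq. Qed.

(** A maximum over an empty family would be 0, so a witness is needed: start from [set0] and apply
    [rbetti_superset] [i] times, as [i <= n - d] permits. *)
Lemma Mshift_attained i : (i <= n - d)%N ->
  exists W : {set 'I_n}, [/\ (i <= #|W|)%N, beta W (#|W| - i) != 0%N & M i = #|W|].
Proof.
move=> le_i; suff [W iW bW] : exists2 W : {set 'I_n}, (i <= #|W|)%N & beta W (#|W| - i) != 0%N.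
  pose P W := (i <= #|W|)%N && (beta W (#|W| - i) != 0%N).
  have [|W' /andP[iW' bW'] eW'] := @eq_bigmax_cond _ P (fun W : {set 'I_n} => #|W|).
    by apply/card_gt0P; exists W; rewrite unfold_in /P iW.
  by exists W'.
elim: i le_i => [|i IH] le_i; first by exists set0; rewrite // cards0 rbetti_set0.
have [W iW bW] := IH (ltnW le_i).
have [|W' WW' bW'] := rbetti_superset _ bW.
  by have := card_vertices_leq W; have := dim_leq; lia.
have := proper_card WW' => ltW; exists W'; first by lia.
by move: bW'; congr (beta _ _ != _); lia.
Qed.

Lemma Mshift_ltS i : (i < n - d)%N -> (M i < M i.+1)%N.
Proof.
move=> le_i; have [W [iW bW ->]] := Mshift_attained (ltnW le_i).
have [|W' WW' bW'] := rbetti_superset _ bW.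
  by have := card_vertices_leq W; have := dim_leq; lia.
have ltW := proper_card WW'; apply: (leq_trans ltW); apply: leq_Mshift; first by lia.
by move: bW'; congr (beta _ _ != _); lia.
Qed.

Lemma Mshift_ltn i j : (i < j <= n - d)%N -> (M i < M j)%N.
Proof.
elim: j => // j IH /andP[ij jn]; have := Mshift_ltS jn.
by move: ij; rewrite ltnS leq_eqVlt => /predU1P[-> //|ij]; apply: ltn_trans;
   apply: IH; rewrite ij ltnW.
Qed.

Lemma Mshift_gt1 i : (0 < i <= n - d)%N -> (1 < M i)%N.
Proof.
case/andP=> i0 le_i; have [|W [iW bW e]] := @Mshift_attained 1; first by lia.
have M1 : (1 < M 1)%N.
  rewrite ltn_neqAle e iW andbT eq_sym; apply/eqP => cW.
  by case/eqP: bW; rewrite cW subnn rbetti_bot0 ?cW.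
move: i0; rewrite leq_eqVlt => /predU1P[<- //|i1].
by apply: ltn_trans M1 _; apply: Mshift_ltn; rewrite i1.
Qed.

End Shifts.

(** * Upper skips as the complement of the shifts *)

Section UpperSkips.

Variables (k : fieldType) (n d : nat) (Gamma : {set {set 'I_n}}).
Hypotheses (hGamma : is_simplicial_complex Gamma) (hdim : has_dim Gamma d).

Notation M := (Mshift k Gamma).
Notation Q := (Qskip k Gamma d).
Notation Ms := [seq M i | i <- iota 1 (n - d)].
Notation skips := (upper_skips k Gamma d).

Lemma sorted_Mshift : sorted ltn Ms.
Proof.
apply: (homo_sorted_in (e := ltn) (P := [pred i | 0 < i <= n - d]%N)).
- by move=> i j /andP[i0 _] /andP[_ jn] ij; apply: (Mshift_ltn k hGamma hdim); apply/andP.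
- by apply/allP => i; rewrite mem_iota inE; lia.
- exact: iota_ltn_sorted.
Qed.

Lemma sorted_skips : sorted ltn skips.
Proof. by rewrite sorted_filter ?iota_ltn_sorted //; apply: ltn_trans. Qed.

Lemma perm_Mshift_skips : perm_eq (Ms ++ skips) (iota 1 n).
Proof.
have uM : uniq Ms by apply: sorted_uniq sorted_Mshift; [apply: ltn_trans|apply: ltnn].
apply: uniq_perm; rewrite ?iota_uniq //.
  rewrite cat_uniq uM filter_uniq ?iota_uniq // andbT /=.
  by apply/hasPn => m; rewrite mem_filter => /andP[].
move=> m; rewrite mem_cat mem_filter; case: (boolP (m \in Ms)) => //= /mapP[i].
rewrite !mem_iota => ri ->; have := Mshift_leq k Gamma i.
by have := Mshift_gt1 k hGamma hdim (i := i); lia.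
Qed.

Lemma size_skips : size skips = d.
Proof.
have := perm_size perm_Mshift_skips; rewrite size_cat size_map !size_iota => e.
by apply/eqP; rewrite -(eqn_add2l (n - d)) [X in X == _]e subnK ?(dim_leq hdim).
Qed.

Lemma Qskip_ltn i j : (i < j < d)%N -> (Q i < Q j)%N.
Proof.
case/andP=> ij jd; apply: (sorted_ltn_nth ltn_trans) => //.
- exact: sorted_skips.
- by rewrite inE size_skips (ltn_trans ij).
- by rewrite inE size_skips.
Qed.

Lemma Qskip_range i : (i < d)%N -> (0 < Q i <= n)%N.
Proof.
move=> id; have : Q i \in skips by rewrite mem_nth ?size_skips.
by rewrite mem_filter mem_iota => /andP[_]; lia.
Qed.

Lemma Qskip0 : (0 < d)%N -> Q 0 = 1%N.
Proof.
move=> d0; have n0 : (0 < n)%N by have := dim_leq hdim; lia.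
have e1 : iota 1 n = 1%N :: iota 2 n.-1 by move: n0; case: (n).
rewrite /Qskip /upper_skips e1 /= ifT //.
apply/mapP=> -[i]; rewrite mem_iota => ri e.
by have := Mshift_gt1 k hGamma hdim (i := i); rewrite -e; lia.
Qed.

Lemma Qskip_gt1 i : (0 < i < d)%N -> (1 < Q i)%N.
Proof. by move=> /[dup] /andP[i0 id] /Qskip_ltn; rewrite Qskip0 //; lia. Qed.

Lemma prod_Mshift_Qskip :
  ((\prod_(1 <= i < (n - d).+1) M i) * \prod_(0 <= u < d) Q u = n`!)%N.
Proof.
have e m : index_iota 1 m.+1 = iota 1 m by rewrite /index_iota subn1.
rewrite fact_prod !e -(perm_big _ perm_Mshift_skips) big_cat big_map /=.
by congr (_ * _)%N; rewrite [RHS](big_nth 0%N) size_skips.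
Qed.

(** Of the [Q i - 1] positive integers below [Q i], exactly [i] are skips. *)
Lemma count_Mshift_lt i : (i < d)%N ->
  count (fun m => m < Q i)%N Ms = (Q i - i.+1)%N.
Proof.
move=> id; have := permP perm_Mshift_skips (fun m => m < Q i)%N.
rewrite count_cat.
have -> : count (fun m => m < Q i)%N skips = i.
  by apply: (@Order.PreorderTheory.count_lt_nth _ nat); rewrite ?size_skips // sorted_skips.
have /andP[Q0 Qn] := Qskip_range id.
have -> : count (fun m => m < Q i)%N (iota 1 n) = (Q i).-1.
  have := @Order.PreorderTheory.count_lt_nth _ nat 0%N (iota 1 n) (Q i).-1.
  rewrite size_iota nth_iota; last by lia.
  by rewrite add1n prednK //; apply; [apply: iota_ltn_sorted | lia].
by move/(canRL (addnK _)) => ->; lia.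
Qed.

(** If [Q i > p.+1], nonzero homology would give [M (Q i - p.+1) >= Q i]. But the first [Q i - i.+1]
    shifts lie below [Q i], and [i <= p] puts this index among them. *)
Lemma rbetti_Qskip i p (W : {set 'I_n}) : (i < d)%N -> (i <= p)%N -> #|W| = Q i ->
  rbetti k Gamma W p.+1 = 0%N.
Proof.
move=> id ip cW; have /andP[Q0 Qn] := Qskip_range id.
have [le_p|lt_p] := leqP (Q i) p.+1.
  by apply: (rbetti_top0 k hGamma); rewrite cW Q0.
have ltj : (Q i - p.+2 < count (fun m => m < Q i)%N Ms)%N.
  by rewrite count_Mshift_lt //; lia.
have := @Order.PreorderTheory.nth_count_lt _ nat (Q i) 0%N Ms (Q i - p.+2).
have sM : sorted leq Ms by apply: sub_sorted sorted_Mshift => a b; apply: ltnW.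
move=> /(_ sM ltj).
have := count_size (fun m => m < Q i)%N Ms; rewrite size_map size_iota => lec.
rewrite (nth_map 0%N) ?size_iota; last by lia.
rewrite nth_iota; last by lia.
move=> ltM; apply/eqP; apply: contraLR ltM => bW.
have -> : (1 + (Q i - p.+2) = #|W| - p.+1)%N by lia.
rewrite -[(_ < _)%O]/(_ < _)%N -leqNgt -cW; apply: leq_Mshift; first by lia.
by rewrite subKn //; lia.
Qed.

End UpperSkips.

(** * The averaged Euler characteristic as a polynomial *)

Section EulerCharacteristic.

Variables (k : fieldType) (n d : nat) (Gamma : {set {set 'I_n}}).
Hypotheses (hGamma : is_simplicial_complex Gamma) (hdim : has_dim Gamma d).

Notation Q := (Qskip k Gamma d).

Lemma euler_poincare (W : {set 'I_n}) :
  \sum_(s < d.+1) (-1) ^+ s * #|faces Gamma W s|%:R =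
  \sum_(s < d.+1) (-1) ^+ s * (rbetti k Gamma W s)%:R :> rat.
Proof.
(* A partial alternating sum leaves the rank of the last boundary as error; at [m = d] it is zero,
   since no face has [d.+1] vertices. *)
have partial m : \sum_(s < m.+1) (-1) ^+ s * #|faces Gamma W s|%:R =
    \sum_(s < m.+1) (-1) ^+ s * (rbetti k Gamma W s)%:R
    + (-1) ^+ m * (\rank (bdmx k Gamma W m))%:R :> rat.
  have e s := congr1 (fun j => j%:R : rat) (card_faces_rbetti k hGamma W s).
  elim: m => [|m IH]; first by rewrite !big_ord1 e addn0 natrD mulrDr.
  rewrite !(big_ord_recr m.+1) /= IH e !natrD exprS.
  by ring.
rewrite partial (_ : \rank _ = 0%N) ?mulr0 ?addr0 //.
apply/eqP; rewrite -leqn0; apply: leq_trans (rank_leq_row _) _.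
rewrite leqn0 cards_eq0; apply/eqP/setP => t; rewrite !inE; apply/negP.
by case/and3P=> /hdim.2 + _ /eqP ct; rewrite ct ltnn.
Qed.

(** Double counting: complements of the sets [W] containing [t] are the [(n - m)]-subsets of [~: t].
    This form of the binomial also vanishes when [m < s <= n]. *)
Lemma sum_card_faces s m : (m <= n)%N ->
  (\sum_(W : {set 'I_n} | #|W| == m) #|faces Gamma W s| =
   fnum Gamma s * 'C(n - s, n - m))%N.
Proof.
move=> mn.
transitivity (\sum_(W : {set 'I_n} | #|W| == m)
    \sum_(t in [set t in Gamma | #|t| == s] | t \subset W) 1)%N.
  apply: eq_bigr => W _; rewrite sum1dep_card; apply: eq_card => t.
  by rewrite !inE -!andbA; congr (_ && _); rewrite andbC.
rewrite (exchange_big_dep (mem [set t in Gamma | #|t| == s])) /=; last first.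
  by move=> W t _ /andP[].
rewrite /fnum -sum1_card big_distrl /=; apply: eq_bigr => t tG.
have ct : #|~: t| = (n - s)%N.
  move: tG; rewrite inE => /andP[_ /eqP <-].
  by rewrite cardsCs setCK card_ord.
rewrite mul1n -ct -cards_draws sum1dep_card.
rewrite -(card_imset _ (@setC_inj _)); apply: eq_card => W.
rewrite !inE; apply/imsetP/andP => [[V]|[Wt /eqP cW]].
  rewrite inE => /andP[/eqP cV /andP[_ tV]] ->; rewrite setCS tV; split=> //.
  by rewrite cardsCs setCK card_ord cV.
exists (~: W); rewrite ?setCK // inE; move: tG; rewrite inE => -> /=; rewrite -setCS setCK Wt andbT.
by rewrite cardsCs setCK card_ord cW subKn.
Qed.

Lemma bin_absorb s m : (s <= m <= n)%N ->
  ('C(n, s) * 'C(n - s, n - m) = 'C(n, m) * 'C(m, s))%N.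
Proof.
case/andP=> sm mn; have sn := leq_trans sm mn.
have f_gt0 : (0 < s`! * ((n - m)`! * (m - s)`!))%N by rewrite !muln_gt0 !fact_gt0.
apply/eqP; rewrite -(eqn_pmul2r f_gt0); apply/eqP.
have e1 := bin_fact sn; have e2 := bin_fact mn; have e3 := bin_fact sm.
have e4 := @bin_fact (n - s) (n - m); rewrite (_ : n - s - (n - m) = m - s)%N in e4; last by lia.
transitivity ('C(n, s) * (s`! * ('C(n - s, n - m) * ((n - m)`! * (m - s)`!))))%N.
  by ring.
rewrite e4 ?e1 -?e2 -?e3; last by lia.
by ring.
Qed.

Definition binom_poly s : {poly rat} :=
  (s`!)%:R^-1 *: \prod_(j < s) ('X - j%:R%:P).

Lemma binom_polyE s m : (binom_poly s).[m%:R] = 'C(m, s)%:R.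
Proof.
rewrite hornerZ horner_prod.
have -> : \prod_(j < s) ('X - j%:R%:P).[m%:R] = (m ^_ s)%:R :> rat.
  elim: s => [|s IH]; first by rewrite big_ord0.
  rewrite big_ord_recr /= IH ffactnSr natrM hornerXsubC.
  have [sm|ms] := leqP s m; first by rewrite natrB.
  by rewrite ffact_small // !mul0r.
by rewrite -bin_ffact natrM mulrC mulfK // pnatr_eq0 -lt0n fact_gt0.
Qed.

Lemma size_binom_poly s : size (binom_poly s) = s.+1.
Proof.
rewrite size_scale ?invr_eq0 ?pnatr_eq0 -?lt0n ?fact_gt0 //.
by rewrite size_prod_XsubC /index_enum -enumT size_enum_ord.
Qed.

Lemma coef_binom_poly s : (binom_poly s)`_s = (s`!)%:R^-1.
Proof.
have := size_binom_poly s; rewrite /binom_poly.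
rewrite size_scale ?invr_eq0 ?pnatr_eq0 -?lt0n ?fact_gt0 // => e.
have := lead_coef_prod_XsubC (index_enum 'I_s) predT (fun j : 'I_s => j%:R : rat).
by rewrite lead_coefE e coefZ => ->; rewrite mulr1.
Qed.

(** A given [s]-set lies in a random [m]-set with probability ['C(m, s) / 'C(n, s)]; hence the value
    at [m] is, up to sign, the average reduced Euler characteristic over the [m]-sets. *)
Definition euler_poly : {poly rat} :=
  \sum_(s < d.+1) ((-1) ^+ s * (fnum Gamma s)%:R / 'C(n, s)%:R) *: binom_poly s.

Lemma size_euler_poly : (size euler_poly <= d.+1)%N.
Proof.
apply: (leq_trans (size_sum _ _ _)); apply/bigmax_leqP => s _.
by apply: leq_trans (size_scale_leq _ _) _; rewrite size_binom_poly ltn_ord.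
Qed.

Lemma coef_euler_poly :
  euler_poly`_d = (-1) ^+ d * ((fnum Gamma d)%:R * ((n - d)`!)%:R / (n`!)%:R).
Proof.
rewrite coef_sum big_ord_recr /= big1 ?add0r => [|s _]; last first.
  by rewrite coefZ nth_default ?mulr0 // size_binom_poly.
have e := bin_fact (dim_leq hdim).
rewrite coefZ coef_binom_poly -e !natrM.
have nz m : (m`!)%:R != 0 :> rat by rewrite pnatr_eq0 -lt0n fact_gt0.
have := nz d; have := nz (n - d)%N.
have : 'C(n, d)%:R != 0 :> rat by rewrite pnatr_eq0 -lt0n bin_gt0 (dim_leq hdim).
by move=> *; field; do ?[apply/andP; split].
Qed.

Lemma euler_poly0 : euler_poly.[0] = 1.
Proof.
rewrite horner_sum big_ord_recl big1 => [|s _].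
  rewrite hornerZ -[X in (binom_poly _).[X]]/(0%:R) binom_polyE !bin0.
  rewrite expr0 mul1r divr1 mulr1 addr0.
  rewrite /fnum (_ : [set _ in _ | _] = [set set0]) ?cards1 //.
  apply/setP=> t; rewrite !inE cards_eq0; case: eqP => [->|]; last by rewrite andbF.
  by have [[u uG _] _] := hdim; rewrite (hGamma.1 _ _ uG) ?sub0set.
by rewrite hornerZ -[X in (binom_poly _).[X]]/(0%:R) binom_polyE bin0n mulr0.
Qed.

Lemma euler_poly_nat m : (m <= n)%N ->
  euler_poly.[m%:R] = (\sum_(W : {set 'I_n} | #|W| == m)
     \sum_(s < d.+1) (-1) ^+ s * (rbetti k Gamma W s)%:R) / 'C(n, m)%:R.
Proof.
move=> mn; under [in RHS]eq_bigr => W _ do rewrite -euler_poincare.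
rewrite exchange_big horner_sum big_distrl /=; apply: eq_bigr => s _.
rewrite hornerZ binom_polyE -big_distrr /= -natr_sum sum_card_faces // natrM.
have Cn j : (j <= n)%N -> 'C(n, j)%:R != 0 :> rat.
  by move=> jn; rewrite pnatr_eq0 -lt0n bin_gt0.
have ns : (s <= n)%N by apply: leq_trans (dim_leq hdim); rewrite -ltnS ltn_ord.
have [sm|ms] := leqP s m; last first.
  rewrite (@bin_small m s) // (@bin_small (n - s) (n - m)) ?mulr0 ?mul0r //; lia.
apply: (mulIf (Cn _ ns)); apply: (mulIf (Cn _ mn)).
have := @bin_absorb s m; rewrite sm mn => /(_ isT) /(congr1 (fun j => j%:R : rat)).
rewrite !natrM => e.
set f := (fnum _ _)%:R; set c := (-1) ^+ s.
transitivity (c * f * ('C(n, m)%:R * 'C(m, s)%:R) * ('C(n, s)%:R / 'C(n, s)%:R)).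
  by ring.
rewrite -e; transitivity (c * f * ('C(n, s)%:R * 'C(n - s, n - m)%:R)).
  by rewrite divff ?mulr1 ?Cn.
transitivity (c * (f * 'C(n - s, n - m)%:R) * 'C(n, s)%:R * ('C(n, m)%:R / 'C(n, m)%:R)).
  by rewrite divff ?Cn // mulr1; ring.
by ring.
Qed.

(** The term of size 0 disappears because [Q i > 0], and the terms with [j >= i] by
    [rbetti_Qskip]. *)
Lemma euler_poly_Qskip i : (i < d)%N ->
  euler_poly.[(Q i)%:R] = \sum_(0 <= j < i) (-1) ^+ j.+1 * Aavg k Gamma j (Q i).
Proof.
move=> id; have /andP[Q0 Qn] := Qskip_range k hGamma hdim id.
rewrite euler_poly_nat // exchange_big big_distrl big_ord_recl /= big1 ?mul0r ?add0r.
  rewrite -(big_mkord predT (fun j => (\sum_(W : {set 'I_n} | #|W| == Q i)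
      (-1) ^+ j.+1 * (rbetti k Gamma W j.+1)%:R) / 'C(n, Q i)%:R)).
  rewrite (big_cat_nat _ (n := i)) //= 1?ltnW // [X in _ + X](_ : _ = 0) ?addr0.
    by apply: eq_bigr => j _; rewrite -big_distrr /= mulrA.
  rewrite big_nat_cond big1 // => j; rewrite andbT => /andP[ij jd].
  rewrite big1 ?mul0r // => W /eqP cW.
  by rewrite (rbetti_Qskip hGamma hdim id ij cW) mulr0.
by move=> W /eqP cW; rewrite (rbetti_bot0 k hGamma) ?mulr0 // cW.
Qed.

End EulerCharacteristic.

(** * Lagrange interpolation and Vandermonde products *)

Lemma coef_lagrange (F : fieldType) (x : nat -> F) m (p : {poly F}) :
  injective x -> (size p <= m.+1)%N ->
  p`_m = \sum_(i < m.+1) p.[x i] / \prod_(j < m.+1 | j != i) (x i - x j).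
Proof.
move=> xI sp; rewrite {1}(lagrange_gen (ltn0Sn m) xI sp) coef_sum.
apply: eq_bigr => i _; have := size_lagrange_ (ltn0Sn m) xI i.
pose q : {poly F} := \prod_(j < m.+1 | j != i) ('X - (x j)%:P).
have Lq : tnth (lagrange m.+1 x) i = (q.[x i]^-1)%:P * q :> {poly F}.
  exact: (lagrangeE (ltn0Sn m) xI i).
rewrite Lq coefCM.
have q0 : q.[x i] != 0.
  rewrite horner_prod; apply/prodf_neq0 => j ji.
  by rewrite hornerXsubC subr_eq0 (inj_eq xI) eq_sym.
rewrite size_Cmul ?invr_eq0 // => sq; rewrite coefCM.
have := lead_coef_prod_XsubC (index_enum 'I_m.+1) (fun j => j != i) (fun j => x j).
rewrite lead_coefE -/q sq /= => ->; rewrite mulr1 horner_prod.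
by under eq_bigr do rewrite hornerXsubC.
Qed.

(** All factors involving [x i] are written as [x i - x v]; each of the [d - i.+1] indices [v > i]
    costs a sign. *)
Lemma vandermonde_extract (R : comRingType) (x : nat -> R) d i : (0 < i < d)%N ->
  \prod_(1 <= u < d) \prod_(u.+1 <= v < d) (x v - x u) =
  (-1) ^+ (d - i.+1) * \prod_(1 <= v < d | v != i) (x i - x v) *
  \prod_(1 <= u < d | u != i) \prod_(u.+1 <= v < d | v != i) (x v - x u).
Proof.
(* [G] pads the triangular double product with ones to a square, so that row and column [i] can be
   split off separately. *)
move=> /andP[i0 id]; pose G u v := if (u < v)%N then x v - x u else 1.
have widen (P : pred nat) u : (0 < u)%N ->
    \prod_(u.+1 <= v < d | P v) (x v - x u) = \prod_(1 <= v < d | P v) G u v.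
  by move=> u0; rewrite (big_nat_widenl _ 1) // big_mkcondr.
have ri : i \in index_iota 1 d by rewrite mem_index_iota i0.
have ur : uniq (index_iota 1 d) by apply: iota_uniq.
rewrite [LHS]big_nat_cond [X in _ = _ * X]big_nat_cond.
rewrite (eq_bigr (fun u => \prod_(1 <= v < d) G u v)); last first.
  by move=> u /andP[/andP[u0 _] _]; apply: widen.
rewrite [X in _ = _ * X](eq_bigr (fun u => \prod_(1 <= v < d | v != i) G u v)); last first.
  by move=> u /andP[/andP[u0 _] _]; apply: widen.
rewrite -[LHS]big_nat_cond -[X in _ = _ * X]big_nat_cond.
rewrite (bigD1_seq i) //=.
rewrite [X in _ * X](eq_bigr (fun u => G u i * \prod_(1 <= v < d | v != i) G u v)); last first.
  by move=> u _; rewrite (bigD1_seq i).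
rewrite big_split /= mulrA (bigD1_seq i) //= {1}/G ltnn mul1r -big_split /=.
congr (_ * _).
have -> : (-1) ^+ (d - i.+1) = \prod_(1 <= v < d | v != i) (if (i < v)%N then -1 else 1) :> R.
  rewrite -prodr_const_nat (big_nat_widenl _ 1) // big_mkcondr /=.
  by rewrite (bigD1_seq i) //= ltnn mul1r.
rewrite -big_split /=; apply: eq_bigr => v vi; rewrite /G.
by case: ltngtP vi => [||->]; rewrite ?eqxx // ?mulN1r ?opprB ?mulr1 ?mul1r.
Qed.

(** * Interpolation at the skips and conclusion *)

Section Interpolation.

Variables (k : fieldType) (n d : nat) (Gamma : {set {set 'I_n}}).
Hypotheses (hGamma : is_simplicial_complex Gamma) (hdim : has_dim Gamma d).

Notation Q := (Qskip k Gamma d).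
Notation q u := ((Q u)%:R : rat).

(** [cco i] is [skip_weight] divided by [skip_node i], up to sign; the factor
[v = 0] of [skip_node i] is [q i - 1]. *)
Definition skip_weight : rat := (\prod_(1 <= u < d) (q u * (q u - 1))) *
  \prod_(1 <= u < d) \prod_(u.+1 <= v < d) (q v - q u).

Definition skip_node i : rat := q i * \prod_(0 <= v < d | v != i) (q i - q v).

Lemma skip_weight_gt0 : 0 < skip_weight.
Proof.
rewrite /skip_weight big_nat_cond [X in _ * X]big_nat_cond mulr_gt0 //; apply: prodr_gt0 => u.
  rewrite andbT => /(Qskip_gt1 k hGamma hdim) Q1.
  by rewrite mulr_gt0 ?subr_gt0 ?ltr1n ?ltr0n // ltnW.
move=> _; rewrite big_nat_cond; apply: prodr_gt0 => v; rewrite andbT => /andP[uv vd].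
by rewrite subr_gt0 ltr_nat (Qskip_ltn k hGamma hdim) // uv.
Qed.

Lemma cco_mul_denominator i : (0 < i < d)%N ->
  cco k Gamma d i * skip_node i = (-1) ^+ (d - i.+1) * skip_weight.
Proof.
move=> id; have /andP[i0 lt_id] := id.
have ri : i \in index_iota 1 d by rewrite mem_index_iota i0.
have ur : uniq (index_iota 1 d) by apply: iota_uniq.
have d0 : (0 < d)%N by apply: leq_trans lt_id.
rewrite /skip_weight (vandermonde_extract (fun u => q u) id) (bigD1_seq i) //= /cco /skip_node.
rewrite [X in _ * (_ * X)]big_mkcond big_ltn // eq_sym -lt0n i0 -big_mkcond /=.
rewrite (Qskip0 k hGamma hdim d0).
set s := (-1) ^+ _; have ss : s * s = 1 by rewrite -expr2 sqrr_sign.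
set a := \prod_(1 <= u < d | _) _; set b := \prod_(1 <= u < d | _) _.
set c := \prod_(1 <= v < d | _) _.
transitivity ((s * s) * (a * b * (q i * ((q i - 1) * c)))); first by rewrite ss mul1r.
by ring.
Qed.

Lemma skip_node_neq0 i : (0 < i < d)%N -> skip_node i != 0.
Proof.
move=> id; have := cco_mul_denominator id; apply: contra_eq_neq => ->.
by rewrite mulr0 eq_sym mulf_neq0 ?signr_eq0 // gt_eqF ?skip_weight_gt0.
Qed.

(** Both sides are [(-1) ^+ d] times the coefficient of degree [d] of [euler_poly]. At the node 0
    the denominator is the product of the [- q u], whose sign cancels that factor. *)
Lemma euler_poly_interpolation :
  (fnum Gamma d)%:R * ((n - d)`!)%:R / (n`!)%:R =
  (\prod_(0 <= u < d) q u)^-1 +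
  \sum_(1 <= i < d) (-1) ^+ d * (euler_poly d Gamma).[q i] / skip_node i.
Proof.
(* The values beyond index [d] only serve to make [xn] injective on [nat]. *)
pose xn i := if i is u.+1 then (if u < d then Q u else n + i)%N else 0%N.
have xn_mono : {homo xn : i j / (i < j)%N}.
  apply: homo_ltn; first exact: ltn_trans.
  case=> [|u] /=.
    by case: ifP => [/(Qskip_range k hGamma hdim)/andP[]|_] //; lia.
  case: ifP => ud; case: ifP => ud1; last by lia.
  - by apply: (Qskip_ltn k hGamma hdim); rewrite ltnSn.
  - by have := Qskip_range k hGamma hdim ud; lia.
  - by lia.
have xI : injective (fun i => (xn i)%:R : rat).
  move=> i j /eqP; rewrite eqr_nat => /eqP e.
  by case: (ltngtP i j) => // /xn_mono; rewrite e ltnn.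
have := coef_lagrange xI (size_euler_poly d Gamma).
rewrite coef_euler_poly // => /(congr1 (fun y => (-1) ^+ d * y)).
rewrite mulrA -expr2 sqrr_sign mul1r => ->.
rewrite big_ord_recl mulrDr (euler_poly0 hGamma hdim); congr (_ + _).
  rewrite big_mkcond big_ord_recl /= mul1r.
  rewrite (eq_bigr (fun u : 'I_d => - q u)); last first.
    by move=> u _; rewrite /= ltn_ord sub0r.
  rewrite prodrN card_ord big_mkord mul1r invfM mulrA.
  by rewrite -exprVn invrN invr1 -expr2 sqrr_sign mul1r.
rewrite big_distrr /=.
rewrite (eq_bigr (fun u : 'I_d =>
  (-1) ^+ d * (euler_poly d Gamma).[q u] / skip_node u)); last first.
  move=> u _; rewrite ltn_ord -mulrA; congr (_ * (_ / _)).
  rewrite big_mkcond big_ord_recl /= subr0 /skip_node; congr (_ * _).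
  rewrite big_mkord [RHS]big_mkcond; apply: eq_bigr => v _ /=.
  by rewrite (inj_eq lift_inj) ltn_ord.
rewrite -(big_mkord predT (fun u => (-1) ^+ d * (euler_poly d Gamma).[q u] / skip_node u)).
have [d0|d0] := posnP d; first by rewrite !big_geq ?d0.
(* The node [Q 0] contributes nothing, because [euler_poly] is an empty sum there. *)
rewrite [LHS]big_ltn // [X in X + _](_ : _ = 0) ?add0r //.
by rewrite (euler_poly_Qskip k hGamma hdim d0) big_geq // mulr0 mul0r.
Qed.

(** Up to positive factors, the criterion is the gap in the bound on [fnum Gamma d], with the bound
    expressed through the skips: it is the node 0 term of the interpolation. *)
Lemma skip_sum_eq :
  \sum_(1 <= i < d) cco k Gamma d i *
     \sum_(0 <= j < i) (-1) ^+ (i - j - 1) * Aavg k Gamma j (Q i) =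
  skip_weight * ((\prod_(0 <= u < d) q u)^-1 - (fnum Gamma d)%:R * ((n - d)`!)%:R / (n`!)%:R).
Proof.
rewrite euler_poly_interpolation opprD addrA subrr add0r mulrN big_distrr -sumrN /=.
rewrite big_nat_cond [RHS]big_nat_cond; apply: eq_bigr => i; rewrite andbT => id.
have /andP[i0 lt_id] := id.
rewrite (euler_poly_Qskip k hGamma hdim lt_id); set S := \sum_(0 <= j < i) _.
(* For [j < i], the exponents [j.+1] and [i + (i - j - 1)] have the same parity. *)
have -> : \sum_(0 <= j < i) (-1) ^+ j.+1 * Aavg k Gamma j (Q i) = (-1) ^+ i * S.
  rewrite big_distrr /= big_nat_cond [RHS]big_nat_cond; apply: eq_bigr => j.
  rewrite andbT => /andP[_ ji]; rewrite mulrA -exprD; congr (_ * _).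
  by rewrite -signr_odd -[RHS]signr_odd; congr (_ ^+ nat_of_bool _); lia.
rewrite (canRL (mulfK (skip_node_neq0 id)) (cco_mul_denominator id)).
have -> : (-1) ^+ (d - i.+1) = - ((-1) ^+ d * (-1) ^+ i) :> rat.
  rewrite -exprD -[RHS]mulN1r -exprS -signr_odd -[RHS]signr_odd.
  by congr (_ ^+ nat_of_bool _); lia.
by ring.
Qed.

End Interpolation.

Theorem theorem2p2 (k : fieldType) (n d : nat) (Gamma : {set {set 'I_n}})
  (hGamma : is_simplicial_complex Gamma) (hdim : has_dim Gamma d) :
  ((fnum Gamma d)%:R
     <= (\prod_(1 <= i < (n - d).+1) (Mshift k Gamma i)%:R) / ((n - d)`!)%:R
   :> rat)
  <->
  (0 <= \sum_(1 <= i < d)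
          cco k Gamma d i *
          \sum_(0 <= j < i) (-1) ^+ (i - j - 1) * Aavg k Gamma j (Qskip k Gamma d i)
   :> rat).
Proof.
rewrite (skip_sum_eq k hGamma hdim) pmulr_rge0; last exact: skip_weight_gt0.
have f_gt0 m : 0 < (m`!)%:R :> rat by rewrite ltr0n fact_gt0.
have := prod_Mshift_Qskip k hGamma hdim.
move/(congr1 (fun j => j%:R : rat)); rewrite natrM !natr_prod => e.
have Q_neq0 : \prod_(0 <= u < d) (Qskip k Gamma d u)%:R != 0 :> rat.
  by apply: contraTneq (f_gt0 n) => z; rewrite -e z mulr0 ltxx.
(* Shifts and skips together multiply to the factorial of [n], which turns the skips back into
   shifts; the common denominator then cancels. *)
have -> : (\prod_(0 <= u < d) (Qskip k Gamma d u)%:R)^-1 =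
    \prod_(1 <= i < (n - d).+1) (Mshift k Gamma i)%:R / (n`!)%:R :> rat.
  apply: (mulIf Q_neq0); rewrite mulVf // mulrAC e divff //.
  by rewrite gt_eqF.
by rewrite subr_ge0 ler_pM2r ?invr_gt0 // ler_pdivlMr.
Qed.
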